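(* Let $k\in\mathbb N$, $k\ge2$, and let $E$ be a symmetric space with the Fatou property. If $E^d$ is compactly fully $k$-rotund, then $E$ is order continuous.
   Context: Let $I=[0,\alpha)$, $\alpha=1$ or $\alpha=\infty$, with Lebesgue measure $\mu$, and $L^0$ the set of (classes of) extended real valued measurable functions on $I$. A Banach function space $(E,\|\cdot\|_E)$ is a Banach lattice that is a sublattice of $L^0$ such that (1) if $x\in L^0$, $y\in E$, $|x|\le|y|$ a.e., then $x\in E$ and $\|x\|_E\le\|y\|_E$; (2) there is a strictly positive $x\in E$. $E^+=\{x\in E:x\ge0\}$; $S_E$ is the unit sphere. Fatou property: if $(x_n)\subset E^+$, $\sup_n\|x_n\|_E<\infty$ and $x_n\uparrow x\in L^0$, then $x\in E$ and $\|x_n\|_E\uparrow\|x\|_E$. For $x\in L^0$: $d_x(\lambda)=\mu\{s\in I:|x(s)|>\lambda\}$, $x^*(t)=\inf\{\lambda>0:d_x(\lambda)\le t\}$. A symmetric space is a Banach function space $E$ such that $x\in L^0$, $y\in E$, $d_x=d_y$ imply $x\in E$ and $\|x\|_E=\|y\|_E$. $E^d=\{x^*:x\in E\}$ (the cone of nonnegative decreasing elements). $E^d$ is compactly fully $k$-rotund if every sequence $(x_n)\subset S_E\cap E^d$ such that $\|\sum_{i=1}^k x_{n,i}\|_E\to k$ as $n\to\infty$ for any $k$ subsequences $(x_{n,1})_n,\dots,(x_{n,k})_n$ of $(x_n)$ forms a relatively compact set. $E$ is order continuous if for every $x\in E$ and every $(x_n)\subset E^+$ with $x_n\le|x|$ and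 $x_n\to0$ a.e. one has $\|x_n\|_E\to0$. *)

(* Defs.v *)
From HB Require Import structures.
From mathcomp Require Import all_boot all_order all_algebra.
From mathcomp Require Import all_classical all_reals all_analysis measurable_realfun.

Set Implicit Arguments.
Unset Strict Implicit.
Unset Printing Implicit Defensive.

Import Order.TTheory GRing.Theory Num.Theory.
Import numFieldNormedType.Exports.

Local Open Scope classical_set_scope.
Local Open Scope ring_scope.

Section SymmetricSpaces.
Context {R : realType}.

Definition halfopen0 (alpha : \bar R) : set R :=
  [set t : R | 0 <= t /\ (t%:E < alpha)%E].

(* Functions are only looked at on I, up to Lebesgue-a.e. equality.  Borel
   measurability suffices: every a.e.-class of Lebesgue measurable functions
   has a Borel representative. *)
Definition L0 (I : set R) : set (R -> \bar R) := [set x : R -> \bar R | measurable_fun I x].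

Definition aeon (I : set R) (P : R -> Prop) : Prop :=
  {ae @lebesgue_measure R, forall t : R, I t -> P t}.

Definition distr (I : set R) (x : R -> \bar R) (lambda : R) : \bar R :=
  lebesgue_measure (I `&` [set s | (lambda%:E < `|x s|)%E]).

Definition rearr (I : set R) (x : R -> \bar R) (t : R) : \bar R :=
  ereal_inf [set lambda%:E | lambda in
    [set lambda : R | 0 < lambda /\ (distr I x lambda <= t%:E)%E]].

(* A Banach function space is presented as a Banach space E together with the
   inclusion ev of E into L^0: ev x is a representative of the class x. *)

Definition represents (I : set R) (E : Type) (ev : E -> R -> \bar R)
  (z : E) (x : R -> \bar R) : Prop := aeon I (fun t => ev z t = x t).

Record banach_function_space (I : set R) (E : completeNormedModType R)
    (ev : E -> R -> \bar R) : Prop := BanachFunctionSpace {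
  bfs_measurable : forall x : E, L0 I (ev x) ;
  bfs_inj : forall x y : E, aeon I (fun t => ev x t = ev y t) -> x = y ;
  (* forced by the vector space structure; recorded because it is what makes
     the pointwise sums below meaningful *)
  bfs_fin : forall x : E, aeon I (fun t => ev x t \is a fin_num) ;
  bfs_add : forall x y : E,
    aeon I (fun t => ev (x + y) t = (ev x t + ev y t)%E) ;
  bfs_scale : forall (a : R) (x : E),
    aeon I (fun t => ev (a *: x) t = (a%:E * ev x t)%E) ;
  bfs_max : forall x y : E, exists z : E,
    represents I ev z (fun t => maxe (ev x t) (ev y t)) ;
  bfs_min : forall x y : E, exists z : E,
    represents I ev z (fun t => mine (ev x t) (ev y t)) ;
  bfs_ideal : forall (x : R -> \bar R) (y : E), L0 I x ->
    aeon I (fun t => (`|x t| <= `|ev y t|)%E) ->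
    exists z : E, represents I ev z x /\ `|z| <= `|y| ;
  bfs_pos : exists x : E, aeon I (fun t => (0 < ev x t)%E)
}.

Record symmetric_space (I : set R) (E : completeNormedModType R)
    (ev : E -> R -> \bar R) : Prop := SymmetricSpace {
  sym_bfs : banach_function_space I ev ;
  sym_distr : forall (x : R -> \bar R) (y : E), L0 I x ->
    (forall lambda : R, 0 <= lambda ->
       distr I x lambda = distr I (ev y) lambda) ->
    exists z : E, represents I ev z x /\ `|z| = `|y|
}.

Definition nneg_cone (I : set R) (E : completeNormedModType R)
    (ev : E -> R -> \bar R) : set E :=
  [set x : E | aeon I (fun t => (0 <= ev x t)%E)].

Definition fatou_property (I : set R) (E : completeNormedModType R)
    (ev : E -> R -> \bar R) : Prop :=
  forall (x_ : nat -> E) (x : R -> \bar R),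
    (forall n, nneg_cone I ev (x_ n)) ->
    has_ubound (range (fun n => `|x_ n|)) ->
    L0 I x ->
    aeon I (fun t => nondecreasing_seq (fun n => ev (x_ n) t) /\
                     ev (x_ n) t @[n --> \oo] --> x t) ->
    exists z : E, [/\ represents I ev z x,
                      nondecreasing_seq (fun n => `|x_ n|) &
                      `|x_ n| @[n --> \oo] --> `|z|].

Definition decr_cone (I : set R) (E : completeNormedModType R)
    (ev : E -> R -> \bar R) : set E :=
  [set z : E | exists x : E, represents I ev z (rearr I (ev x))].

Definition compactly_fully_rotund (k : nat) (E : completeNormedModType R)
    (D : set E) : Prop :=
  forall x_ : nat -> E,
    (forall n, `|x_ n| = 1 /\ D (x_ n)) ->
    (forall phi : 'I_k -> nat -> nat,
       (forall i, {homo phi i : m n / (m < n)%N}) ->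
       `|\sum_(i < k) x_ (phi i n)| @[n --> \oo] --> (k%:R : R)) ->
    precompact (range x_).

Definition order_continuous (I : set R) (E : completeNormedModType R)
    (ev : E -> R -> \bar R) : Prop :=
  forall (x : E) (x_ : nat -> E),
    (forall n, nneg_cone I ev (x_ n)) ->
    (forall n, aeon I (fun t => (ev (x_ n) t <= `|ev x t|)%E)) ->
    aeon I (fun t => ev (x_ n) t @[n --> \oo] --> (0 : \bar R)%E) ->
    `|x_ n| @[n --> \oo] --> (0 : R).

End SymmetricSpaces.

(* Main.v *)
Require Import Defs.
From HB Require Import structures.
From mathcomp Require Import all_boot all_order all_algebra.
From mathcomp Require Import all_classical all_reals all_analysis measurable_realfun.

Set Implicit Arguments.
Unset Strict Implicit.
Unset Printing Implicit Defensive.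

Import Order.TTheory GRing.Theory Num.Theory.
Import numFieldNormedType.Exports.

Local Open Scope classical_set_scope.
Local Open Scope ring_scope.

(** If w_n >= 0 decreases in E and d_{w_n}(l) -> 0 for every l > 0, then
    |w_n| -> 0: otherwise the normalized rearrangements y_n of the w_n have
    asymptotically a common minorant of norm 1, so the norms of k-fold sums of
    subsequences tend to k, and compactness yields a cluster point of norm 1.
    But c y_m <= (w_n)^* for m >= n, where c = lim |w_n|, so a cluster point
    lies below all multiples c^-1 (w_n)^*, which tend to 0 a.e.; thus it is 0.
    Order continuity follows with w_n = sup_{m >= n} x_m, because d_{w_n}(l)
    decreases to 0 by continuity of the measure from above as soon as
    d_x(l) < oo.  If d_x(l) = oo, then alpha = oo and 1 is in E; by the Fatou
    property the normalized indicators of [0, n) then satisfy the rotundity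
    hypothesis, yet they have no cluster point since
    |1_[n,n+1)| = |1_[0,1)| for all n. *)

(** * Almost-everywhere statements on an interval *)

Global Instance aeon_filter {R : realType} (I : set R) : Filter (aeon I).
Proof.
have F := ae_filter_ringOfSetsType (@lebesgue_measure R).
exact: (@within_filter _ I _ F).
Qed.

Lemma aeonT {R : realType} (I : set R) : aeon I I.
Proof. exact/aeW. Qed.

Lemma aeon_all {R : realType} (I : set R) (P : R -> Prop) :
  (forall t, I t -> P t) -> aeon I P.
Proof. by move=> h; exact/aeW. Qed.

Lemma aeon_foralln {R : realType} (I : set R) (P : nat -> R -> Prop) :
  (forall n, aeon I (P n)) -> aeon I (fun t => forall n, P n t).
Proof.
move=> h; have /ae_foralln := h.
by apply: filterS => t ht It n; exact: ht.
Qed.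

Definition leE {R : realType} (I : set R) (E : completeNormedModType R)
    (ev : E -> R -> \bar R) (a b : E) : Prop :=
  aeon I (fun t => (ev a t <= ev b t)%E).

(** * Order and norm in a Banach function space *)

Section BanachFunctionSpace.
Context {R : realType} {I : set R} {E : completeNormedModType R}
  {ev : E -> R -> \bar R} (hE : banach_function_space I ev).

Lemma ev0 : aeon I (fun t => ev 0 t = 0%E).
Proof.
have := bfs_scale hE 0 0.
by apply: filterS => t; rewrite scale0r mul0e.
Qed.

Lemma evN (x : E) : aeon I (fun t => ev (- x) t = (- ev x t)%E).
Proof.
have := bfs_scale hE (-1) x.
by apply: filterS => t; rewrite scaleN1r EFinN mulN1e.
Qed.

Lemma evB (x y : E) : aeon I (fun t => ev (x - y) t = (ev x t - ev y t)%E).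
Proof. by apply: (filterS2 _ _ (bfs_add hE x (- y)) (evN y)) => t -> ->. Qed.

Lemma leE_trans (b a c : E) : leE I ev a b -> leE I ev b c -> leE I ev a c.
Proof. by apply: filterS2 => t; exact: le_trans. Qed.

Lemma leEP (a : E) : leE I ev 0 a <-> aeon I (fun t => (0 <= ev a t)%E).
Proof. by split=> h; apply: (filterS2 _ _ ev0 h) => t ->. Qed.

Lemma leED (a b c d : E) : leE I ev a b -> leE I ev c d -> leE I ev (a + c) (b + d).
Proof.
move=> ab cd; apply: (filterS2 _ _ (filterI (bfs_add hE a c) (bfs_add hE b d))
  (filterI ab cd)) => t [-> ->] [? ?].
exact: leeD.
Qed.

Lemma leE_sum (K : finType) (f g : K -> E) :
  (forall i, leE I ev (f i) (g i)) -> leE I ev (\sum_i f i) (\sum_i g i).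
Proof.
move=> h; elim/big_ind2: _ => // [|a b c d]; last exact: leED.
by apply: aeon_all => t _.
Qed.

Lemma leEZ (r : R) (a b : E) : 0 <= r -> leE I ev a b -> leE I ev (r *: a) (r *: b).
Proof.
move=> r0 ab; apply: (filterS3 _ _ (bfs_scale hE r a) (bfs_scale hE r b) ab).
by move=> t -> -> ?; rewrite lee_wpmul2l.
Qed.

Lemma leEZr (r s : R) (a : E) :
  r <= s -> leE I ev 0 a -> leE I ev (r *: a) (s *: a).
Proof.
move=> rs /leEP a0.
apply: (filterS3 _ _ (bfs_scale hE r a) (bfs_scale hE s a) a0).
by move=> t -> -> ?; rewrite lee_wpmul2r// lee_fin.
Qed.

(** The ideal property only provides some [z] representing [ev a]; injectivity of [ev] on classes
    identifies it with [a]. *)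
Lemma norm_le_ae (a b : E) :
  aeon I (fun t => (`|ev a t| <= `|ev b t|)%E) -> `|a| <= `|b|.
Proof.
move=> ab; have [z [za]] := bfs_ideal hE (bfs_measurable hE a) ab.
suff -> : z = a by [].
exact: (bfs_inj hE).
Qed.

Lemma leE_norm (a b : E) : leE I ev 0 a -> leE I ev a b -> `|a| <= `|b|.
Proof.
move=> a0 ab; apply: norm_le_ae; apply: (filterS3 _ _ ev0 a0 ab) => t -> {}a0 {}ab.
by rewrite !gee0_abs// (le_trans a0).
Qed.

Lemma leE_refl (a : E) : leE I ev a a.
Proof. exact: aeon_all. Qed.

Lemma leE_anti (a b : E) : leE I ev a b -> leE I ev b a -> a = b.
Proof.
move=> ab ba; apply: (bfs_inj hE); apply: (filterS2 _ _ ab ba) => t ? ?.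
by apply/eqP; rewrite eq_le; apply/andP.
Qed.

Lemma leEN (a b : E) : leE I ev a b -> leE I ev (- b) (- a).
Proof.
move=> ab; apply: (filterS3 _ _ (evN a) (evN b) ab) => t -> ->.
by rewrite leeN2.
Qed.

(* The positive part of a - b is an element of E dominated by elements of
   arbitrarily small norm. *)
Lemma leE_of_small (a b : E) :
  (forall eps : R, 0 < eps -> exists2 e : E, `|e| < eps & leE I ev (a - b) e) ->
  leE I ev a b.
Proof.
move=> h; have [p hp] := bfs_max hE (a - b) 0.
have p0 : p = 0.
  apply/eqP; rewrite -normr_le0; apply/ler_addgt0Pl => eps eps0.
  have [e e_lt ze] := h _ eps0.
  rewrite addr0 (le_trans _ (ltW e_lt))//; apply: norm_le_ae.
  apply: (filterS3 _ _ hp ev0 ze) => t -> -> {}ze.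
  rewrite gee0_abs ?le_max ?lexx ?orbT// ge_max abse_ge0 andbT.
  by rewrite (le_trans ze)// lee_abs.
have ab0 : leE I ev (a - b) 0.
  by apply: filterS hp => t; rewrite p0 => ->; rewrite le_max lexx.
by have := leED ab0 (leE_refl b); rewrite subrK add0r.
Qed.

End BanachFunctionSpace.

(** * Distribution functions and decreasing rearrangements *)

Section Distribution.
Context {R : realType} {I : set R} (mI : measurable I).
Implicit Types x y : R -> \bar R.

Lemma measurable_distr_set x (lambda : R) : L0 I x ->
  measurable (I `&` [set s | (lambda%:E < `|x s|)%E]).
Proof.
move=> mx; have m : measurable_fun I (fun s => `|x s|%E).
  exact: measurableT_comp.
exact: emeasurable_fun_o_infty.
Qed.

Lemma distr_ge0 x lambda : (0 <= distr I x lambda)%E.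
Proof. exact: measure_ge0. Qed.

Lemma distr_le_ae x y lambda : L0 I x -> L0 I y ->
  aeon I (fun t => (`|x t| <= `|y t|)%E) ->
  (distr I x lambda <= distr I y lambda)%E.
Proof.
move=> mx my [N [mN N0 xyN]]; rewrite /distr.
(* The level set of [x] lies in that of [y] enlarged by the exceptional null set [N]. *)
rewrite (@le_trans _ _ (lebesgue_measure
  ((I `&` [set s | (lambda%:E < `|y s|)%E]) `|` N)))//.
  apply: le_measure; rewrite ?inE; [exact: measurable_distr_set| |].
    by apply: measurableU => //; exact: measurable_distr_set.
  move=> t /= [It ltx]; have [Nt|nNt] := pselect (N t); [by right|left].
  split=> //; apply: (lt_le_trans ltx); apply: contrapT => nle.
  by apply: nNt; apply: xyN => /= /(_ It).
rewrite (le_trans (measureU2 _ _ _))//; first exact: measurable_distr_set.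
by rewrite [X in (_ + X)%E](_ : _ = 0%E)// adde0.
Qed.

Lemma distr_eq_ae x y lambda : L0 I x -> L0 I y -> aeon I (fun t => x t = y t) ->
  distr I x lambda = distr I y lambda.
Proof.
move=> mx my xy; apply/eqP; rewrite eq_le !distr_le_ae//;
  by apply: filterS xy => t ->.
Qed.

Lemma distr_nonincreasing x (a b : R) : L0 I x -> a <= b ->
  (distr I x b <= distr I x a)%E.
Proof.
move=> mx ab; apply: le_measure; rewrite ?inE; [exact: measurable_distr_set..|].
by move=> t [It /= h]; split => //=; rewrite (le_lt_trans _ h)// lee_fin.
Qed.

(** Continuity of the measure from below: the set where |x| > a is the increasing union of the sets
    where |x| > a + 1/(n+1). *)
Lemma distr_right_cts x (a : R) (d : \bar R) : L0 I x ->
  (forall b, a < b -> (distr I x b <= d)%E) -> (distr I x a <= d)%E.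
Proof.
move=> mx h.
pose F (n : nat) := I `&` [set s | ((a + n.+1%:R^-1)%:E < `|x s|)%E].
have mF n : measurable (F n) by exact: measurable_distr_set.
have FE : \bigcup_n F n = I `&` [set s | (a%:E < `|x s|)%E].
  apply/seteqP; split=> [t [n _ [It /= h']]|t [It /= axt]].
    by split=> //=; rewrite (lt_trans _ h')// lte_fin ltrDl invr_gt0.
  suff [n hn] : exists n : nat, ((a + n.+1%:R^-1)%:E < `|x t|)%E by exists n.
  case: (`|x t|)%E axt => [r| |]//; last by exists 0%N; rewrite ltry.
  rewrite lte_fin -subr_gt0 => /ltr_add_invr[n].
  by rewrite add0r => hn; exists n; rewrite lte_fin -ltrBrDl.
have := @nondecreasing_cvg_mu _ _ _ (@lebesgue_measure R) F mF.
rewrite FE => /(_ (measurable_distr_set _ mx)) cvgF.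
apply: (cvge_le _ (cvgF _)).
  by apply: nearW => n; apply: h; rewrite ltrDl invr_gt0.
move=> m n mn; apply/subsetPset => t [It /= ht]; split => //=.
by rewrite (le_lt_trans _ ht)// lee_fin lerD2l lef_pV2 ?posrE// ler_nat ltnS.
Qed.

Lemma rearr_ge0 x t : (0 <= rearr I x t)%E.
Proof. by apply: le_ereal_inf_tmp => _ [l [l0 _] <-]; rewrite lee_fin ltW. Qed.

(** The rearrangement is the generalized inverse of the distribution function. Right continuity of
    the latter makes the equivalence exact with strict inequalities, and identities between
    rearrangements reduce to it. *)
Lemma rearr_gtP x (lambda t : R) : L0 I x -> 0 <= lambda ->
  (lambda%:E < rearr I x t)%E = (t%:E < distr I x lambda)%E.
Proof.
move=> mx l0; apply/idP/idP; apply: contraTT; rewrite -!leNgt => h.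
  (* The infimum runs over strictly positive levels and [lambda] may be 0, hence the shift by
     [e]. *)
  apply/lee_addgt0Pr => e e0; apply: ereal_inf_lbound; exists (lambda + e) => //.
  split; first by rewrite ltr_wpDl.
  by rewrite (le_trans _ h)// distr_nonincreasing// lerDl ltW.
(* If t < d_x(b), then by monotonicity every admissible level is at least [b], so the rearrangement
   at [t] is at least b > lambda. *)
apply: distr_right_cts => // b lb; rewrite leNgt; apply/negP => tb.
have /(le_lt_trans h) : (lambda%:E < b%:E)%E by rewrite lte_fin.
rewrite ltNge => /negP; apply; apply: le_ereal_inf_tmp => _ [c [c0 ct] <-].
rewrite lee_fin leNgt; apply/negP => cb.
have := lt_le_trans tb (distr_nonincreasing mx (ltW cb)).
by rewrite ltNge ct.
Qed.

Lemma rearr_le x y t : (forall lambda, 0 < lambda ->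
  (distr I x lambda <= distr I y lambda)%E) -> (rearr I x t <= rearr I y t)%E.
Proof.
move=> h; apply: ereal_inf_le_tmp => _ [l [l0 hl] <-].
by exists l => //; split => //; rewrite (le_trans (h _ l0)).
Qed.

End Distribution.

Lemma eq_of_lt_fin {R : realType} (f g : \bar R) : (0 <= f)%E -> (0 <= g)%E ->
  (forall r : R, 0 <= r -> (r%:E < f)%E = (r%:E < g)%E) -> f = g.
Proof.
suff H (a b : \bar R) : (0 <= a)%E -> (0 <= b)%E ->
    (forall r : R, 0 <= r -> (r%:E < a)%E = (r%:E < b)%E) -> (a <= b)%E.
  move=> f0 g0 fg; apply/eqP; rewrite eq_le.
  by apply/andP; split; apply: H => // r r0; rewrite fg.
move=> a0 b0 ab; rewrite leNgt; apply/negP => ba.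
case: b b0 ab ba => [b b0 ab ba|_ _|//]; last by rewrite ltNge leey.
by have := ab b b0; rewrite ba ltxx.
Qed.

(** * Intervals [0, a) and equimeasurability of the rearrangement *)

Section HalfOpen.
Context {R : realType}.
Implicit Types (a : \bar R) (x : R -> \bar R).

Lemma halfopen0_fin (r : R) : halfopen0 r%:E = `[0, r[%classic.
Proof.
by apply/seteqP; split => t; rewrite /halfopen0 /= in_itv/= lte_fin => /andP.
Qed.

Lemma halfopen0_pinfty : halfopen0 (+oo : \bar R)%E = `[0, +oo[%classic.
Proof.
apply/seteqP; split => t; rewrite /halfopen0 /= in_itv/= andbT; first by case.
by move=> ->; rewrite ltry.
Qed.

Lemma measurable_halfopen0 a : measurable (halfopen0 a).
Proof.
case: a => [r| |].
- by rewrite halfopen0_fin.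
- by rewrite halfopen0_pinfty.
- by rewrite (_ : halfopen0 _ = set0)//; apply/seteqP; split => t [].
Qed.

Lemma lebesgue_measure_halfopen0 a : (0 <= a)%E ->
  lebesgue_measure (halfopen0 a) = a.
Proof.
case: a => [r| |]//; rewrite ?lee_fin => r0.
- rewrite halfopen0_fin lebesgue_measure_itv/= lte_fin.
  case: ltP => [_|r_le0]; first by rewrite oppr0 adde0.
  by congr (_%:E); apply/eqP; rewrite eq_le r0 r_le0.
- by rewrite halfopen0_pinfty lebesgue_measure_itv/= ltry.
Qed.

Lemma halfopen0I a b : halfopen0 a `&` [set t : R | (t%:E < b)%E] =
  halfopen0 (mine a b).
Proof.
apply/seteqP; split => t; rewrite /halfopen0/= lt_min; first by move=> [[-> ->] ->].
by move=> [-> /andP[]].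
Qed.

(** By [rearr_gtP] the superlevel sets at r >= 0 are initial intervals; for r < 0 they are the whole
    domain. *)
Lemma measurable_rearr a x : L0 (halfopen0 a) x ->
  L0 (halfopen0 a) (rearr (halfopen0 a) x).
Proof.
move=> mx; apply: (measurability _ (ErealGenOInfty.measurableE R)) => //.
move=> _ [_ [r ->] <-]; have [r0|r0] := leP 0 r.
  rewrite (_ : _ `&` _ = halfopen0 (mine a (distr (halfopen0 a) x r))).
    exact: measurable_halfopen0.
  rewrite -halfopen0I; apply/seteqP; split => t /= []; rewrite in_itv/= ?andbT;
  by rewrite rearr_gtP//; exact: measurable_halfopen0.
rewrite (_ : _ `&` _ = halfopen0 a); first exact: measurable_halfopen0.
apply/seteqP; split => [t []//|t at_]; split => //=.
by rewrite in_itv/= andbT (lt_le_trans _ (rearr_ge0 _ _))// lte_fin.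
Qed.

(** The superlevel set of x^* is [0, min(a, d_x(lambda))), and d_x(lambda) never exceeds the measure
    [a] of the domain. For a < 0 the domain is empty and both sides vanish. *)
Lemma distr_rearr a x (lambda : R) : L0 (halfopen0 a) x -> 0 <= lambda ->
  distr (halfopen0 a) (rearr (halfopen0 a) x) lambda =
  distr (halfopen0 a) x lambda.
Proof.
move=> mx l0; have mI := measurable_halfopen0 a.
have -> : distr (halfopen0 a) (rearr (halfopen0 a) x) lambda = lebesgue_measure
    (halfopen0 (mine a (distr (halfopen0 a) x lambda))).
  congr lebesgue_measure; rewrite -halfopen0I; apply/seteqP.
  by split => t /= []; rewrite gee0_abs ?rearr_ge0// rearr_gtP.
have [a0|a0] := leP 0%E a; last first.
  rewrite /distr (_ : halfopen0 a = set0); last first.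
    apply/seteqP; split => t [] // t0; rewrite ltNge => /negP; apply.
    by rewrite (le_trans (ltW a0)).
  rewrite set0I measure0 min_l ?(ltW a0)// (_ : halfopen0 a = set0) ?measure0//.
  apply/seteqP; split => t [] // t0; rewrite ltNge => /negP; apply.
  by rewrite (le_trans (ltW a0)).
rewrite lebesgue_measure_halfopen0; last by rewrite le_min a0 distr_ge0.
rewrite min_r// -[leRHS]lebesgue_measure_halfopen0//.
by apply: le_measure; rewrite ?inE//; exact: measurable_distr_set.
Qed.

End HalfOpen.

(** * Rearrangements inside a symmetric space *)

Section SymmetricSpace.
Context {R : realType} {alpha : \bar R} {E : completeNormedModType R}
  {ev : E -> R -> \bar R}.
Let I := halfopen0 alpha.
Context (hE : symmetric_space I ev).
Let hB : banach_function_space I ev := sym_bfs hE.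
Let mI : measurable I := measurable_halfopen0 alpha.
Let mev (x : E) : L0 I (ev x) := bfs_measurable hB x.

Lemma distrZ (c : R) (x : E) (lambda : R) : 0 < c ->
  distr I (ev (c *: x)) lambda = distr I (ev x) (lambda / c).
Proof.
move=> c0; have mcx : L0 I (fun t => (c%:E * ev x t)%E).
  by apply: measurable_funeM; exact: mev.
rewrite (@distr_eq_ae _ _ mI _ (fun t => (c%:E * ev x t)%E))//; last first.
  exact: bfs_scale hB c x.
congr lebesgue_measure; apply/seteqP; split => t [It] /=;
  rewrite abseM abse_EFin gtr0_norm//;
  by rewrite EFinM [(lambda%:E * _)%E]muleC lte_pdivrMl//.
Qed.

Lemma rearrZ (c : R) (x : E) (t : R) : 0 < c ->
  rearr I (ev (c *: x)) t = (c%:E * rearr I (ev x) t)%E.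
Proof.
move=> c0; apply: eq_of_lt_fin; first exact: rearr_ge0.
  by rewrite mule_ge0 ?rearr_ge0// lee_fin ltW.
move=> r r0; rewrite rearr_gtP// distrZ//.
rewrite -rearr_gtP// ?divr_ge0 ?(ltW c0)//.
by rewrite EFinM muleC lte_pdivrMl.
Qed.

Lemma decr_coneZ (c : R) (u : E) : 0 < c ->
  decr_cone I ev u -> decr_cone I ev (c *: u).
Proof.
move=> c0 [x ux]; exists (c *: x).
by apply: (filterS2 _ _ (bfs_scale hB c u) ux) => t -> ->; rewrite rearrZ.
Qed.

Lemma exists_rearr (w : E) :
  exists u : E, represents I ev u (rearr I (ev w)) /\ `|u| = `|w|.
Proof.
apply: (sym_distr hE); first exact: measurable_rearr.
by move=> l l0; exact: distr_rearr.
Qed.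

End SymmetricSpace.

(** * From rotundity to a cluster point *)

(** A common minorant [w] of [k] terms bounds the norm of their sum below by k |w| >= k (1 - eps),
    while the triangle inequality bounds it above by k. The minorant may depend on the last index
    [N], since for a decreasing sequence of functions it must. *)
Lemma rotund_cluster {R : realType} {I : set R} {E : completeNormedModType R}
    {ev : E -> R -> \bar R} (hB : banach_function_space I ev)
    (k : nat) (D : set E) (y : nat -> E) :
  compactly_fully_rotund k D -> (forall n, `|y n| = 1 /\ D (y n)) ->
  (forall eps : R, 0 < eps -> exists n0, forall N, exists w : E,
     [/\ leE I ev 0 w, 1 - eps <= `|w| &
         forall n, (n0 <= n <= N)%N -> leE I ev w (y n)]) ->
  exists l : E, forall (eps : R) (N : nat), 0 < eps ->
    exists2 n, (N <= n)%N & `|y n - l| < eps.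
Proof.
move=> hrot hy hw.
have hsum : precompact (range y).
  apply: (hrot y hy) => phi hphi.
  have phi_ge i n : (n <= phi i n)%N.
    elim: n => // n ih; apply: leq_ltn_trans ih _; exact: hphi.
  apply/cvgrPdist_le => eps eps0.
  (* Dividing by [k.+1] is safe for every [k] and still gives k (eps / (k+1)) <= eps. *)
  have k1 : 0 < k.+1%:R :> R by [].
  have [n0 hn0] := hw (eps / k.+1%:R) (divr_gt0 eps0 k1).
  exists n0 => // n /= n0n.
  (* All indices [phi i n] lie between [n0] and their maximum, as [phi i n >= n]. *)
  have [w [w0 hw1 wy]] := hn0 (\max_(i < k) phi i n)%N.
  have sum_le : `|\sum_(i < k) y (phi i n)| <= k%:R.
    rewrite (le_trans (ler_norm_sum _ _ _))//.
    rewrite (eq_bigr (fun _ => 1)); last by move=> i _; rewrite (hy _).1.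
    by rewrite sumr_const card_ord.
  rewrite ger0_norm ?subr_ge0// lerBlDl -lerBlDr.
  have : `|\sum_(i < k) w| <= `|\sum_(i < k) y (phi i n)|.
    apply: (leE_norm hB).
      have := leE_sum hB (fun i : 'I_k => w0); rewrite big1//.
    apply: (leE_sum hB) => i; apply: wy.
    by rewrite (leq_trans n0n (phi_ge i n))/= (leq_bigmax i).
  apply: le_trans.
  rewrite sumr_const card_ord -(scaler_nat k w) normrZ normr_nat.
  rewrite (@le_trans _ _ (k%:R * (1 - eps / k.+1%:R)))//; last exact: ler_wpM2l.
  rewrite mulrBr mulr1 lerD2l lerN2 mulrCA ler_piMr ?(ltW eps0)//.
  by rewrite ler_pdivrMr// mul1r ler_nat.
move: hsum; rewrite precompactE => /(_ (y @ \oo)).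
have PF : ProperFilter (y @ \oo) by exact: fmap_proper_filter.
move=> /(_ PF) [|l [_ cl]].
  exists 0%N => // n _ /=; apply: subset_closure; exists n => //.
exists l => eps N eps0.
(* The cluster point is tested against a tail of the sequence, which yields arbitrarily large
   indices. *)
have [|z [[n /= Nn <-] lz]] := cl [set y n | n in [set n | (N <= n)%N]]
    (ball l eps) _ (nbhsx_ballx l eps eps0).
  by exists N => // n /= Nn; exists n.
by exists n => //; rewrite distrC; move: lz; rewrite -ball_normE.
Qed.

(** The origin is a null set. It is discarded because [t] itself will serve as a strictly positive
    bound on a distribution function. *)
Lemma aeon_gt0 {R : realType} (alpha : \bar R) :
  aeon (halfopen0 alpha) (fun t => 0 < t).
Proof.
exists [set 0]; split => //; first exact: lebesgue_measure_set1.
move=> t /=; apply: contra_notP => t0 [+ _]; rewrite le_eqVlt => /orP[/eqP h|//].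
by exfalso; apply: t0; rewrite h.
Qed.

(** * Norm convergence from convergence of the distribution functions *)

Section KeyLemma.
Context {R : realType} {alpha : \bar R} {E : completeNormedModType R}
  {ev : E -> R -> \bar R}.
Let I := halfopen0 alpha.
Context (hE : symmetric_space I ev).
Let hB : banach_function_space I ev := sym_bfs hE.
Let mI : measurable I := measurable_halfopen0 alpha.
Let mev (x : E) : L0 I (ev x) := bfs_measurable hB x.

Lemma norm_cvg0_of_distr (k : nat) (w : nat -> E) :
  compactly_fully_rotund k (decr_cone I ev) ->
  (forall n, leE I ev 0 (w n)) ->
  (forall m n, (m <= n)%N -> leE I ev (w n) (w m)) ->
  (forall lambda d : R, 0 < lambda -> 0 < d ->
     exists n, (distr I (ev (w n)) lambda <= d%:E)%E) ->
  `|w n| @[n --> \oo] --> (0 : R).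
Proof.
move=> hrot w_ge0 w_anti w_distr.
have [u hu] := choice (fun n => exists_rearr hE (w n)).
have u_ge0 n : leE I ev 0 (u n).
  apply/(leEP hB); apply: filterS (hu n).1 => t ->; exact: rearr_ge0.
have u_anti m n : (m <= n)%N -> leE I ev (u n) (u m).
  move=> mn; apply: (filterS2 _ _ (hu n).1 (hu m).1) => t -> ->.
  apply: rearr_le => l l0; apply: distr_le_ae => //.
  apply: (filterS3 _ _ (ev0 hB) (w_ge0 n) (w_anti _ _ mn)) => s -> a b.
  by rewrite !gee0_abs// (le_trans a).
have norm_anti m n : (m <= n)%N -> `|u n| <= `|u m|.
  by move=> mn; apply: (leE_norm hB); [exact: u_ge0|exact: u_anti].
rewrite (_ : (fun n => `|w n|) = (fun n => `|u n|)); last first.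
  by apply/funext => n; rewrite (hu n).2.
pose c := inf (range (fun n => `|u n|)).
have lb : has_lbound (range (fun n => `|u n|)) by exists 0 => _ [n _ <-].
have cvg_c : `|u n| @[n --> \oo] --> c by apply: nonincreasing_cvgn.
have c_le n : c <= `|u n| by apply: ge_inf => //; exists n.
have c_ge0 : 0 <= c.
  by apply: lb_le_inf; [exists `|u 0%N|; exists 0%N|move=> _ [n _ <-]].
have [c0|c_neq0] := eqVneq c 0; first by rewrite -c0.
have c_gt0 : 0 < c by rewrite lt_neqAle eq_sym c_neq0.
have u_gt0 n : 0 < `|u n| by exact: lt_le_trans (c_le n).
pose y n := `|u n|^-1 *: u n.
have norm_y n : `|y n| = 1.
  by rewrite normrZ normfV normr_id mulVf// gt_eqF.
exfalso.
have [|eps eps0|l hl] := @rotund_cluster _ _ _ _ hB k _ y hrot.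
- move=> n; split => //; apply: decr_coneZ => //; first by rewrite invr_gt0.
  by exists (w n); exact: (hu n).1.
- have /cvgrPdist_le/(_ (eps * c) (mulr_gt0 eps0 c_gt0))[n0 _] := cvg_c.
  move=> /(_ n0 (leqnn n0)) /=; rewrite distrC ger0_norm ?subr_ge0// => hn0.
  (* Among the indices from [n0] to [N], the function is smallest at [N], while the factor
     [|u n|^-1] is smallest at [n0] because the norms decrease. The norm is at least c / |u n0| >= 1
     - eps. *)
  exists n0 => N; exists (`|u n0|^-1 *: u N); split.
  + rewrite -(scaler0 _ `|u n0|^-1); exact: leEZ.
  + rewrite normrZ normfV normr_id mulrC ler_pdivlMr//.
    rewrite (le_trans _ (c_le N))// mulrBl mul1r lerBlDr -lerBlDl.
    by rewrite (le_trans hn0)// ler_pM2l.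
  + move=> n /andP[n0n nN]; apply: (@leE_trans _ _ _ _ (`|u n|^-1 *: u N)).
      by apply: leEZr => //; rewrite lef_pV2 ?posrE//; exact: norm_anti.
    by apply: leEZ => //; exact: u_anti.
(* The coefficient c / |u m| is at most 1, as [c] is the infimum of the norms. *)
have cy_le m n : (n <= m)%N -> leE I ev (c *: y m) (u n).
  move=> nm; apply: (@leE_trans _ _ _ _ (u m)); last exact: u_anti.
  rewrite /y scalerA -[X in leE _ _ _ X]scale1r; apply: leEZr => //.
  by rewrite ler_pdivrMr// mul1r.
have cl_le n : leE I ev (c *: l) (u n).
  apply: (leE_of_small hB) => eps eps0.
  have [m nm hm] := hl (eps / c) n (divr_gt0 eps0 c_gt0).
  (* Since c y_m <= u_n, the difference c l - u_n is at most c (l - y_m), which is small in norm. *)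
  exists (c *: (l - y m)).
    by rewrite normrZ gtr0_norm// distrC mulrC -ltr_pdivlMr.
  rewrite scalerBr; apply: leED => //; first exact: leE_refl.
  by apply: (leEN hB); exact: cy_le.
have l_ge0 : leE I ev 0 l.
  apply: (leE_of_small hB) => eps eps0; have [m _ hm] := hl eps 0%N eps0.
  exists (y m - l) => //; apply: leED => //; last exact: leE_refl.
  by rewrite -(scaler0 _ `|u m|^-1); exact: leEZ.
have cl_le0 : leE I ev (c *: l) 0.
  have ae_cl := aeon_foralln cl_le.
  have ae_u := aeon_foralln (fun n => (hu n).1).
  apply: (filterS3 _ _ (filterI ae_cl ae_u) (aeon_gt0 alpha) (ev0 hB)).
  move=> t [clt ut] t0 ->; apply/lee_addgt0Pr => lam lam0; rewrite add0e.
  (* Once d_{w_n}(lam) <= t, the level [lam] is admissible in the infimum defining (w_n)^*(t). *)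
  have [n hn] := w_distr lam t lam0 t0.
  by rewrite (le_trans (clt n))// ut; apply: ereal_inf_lbound; exists lam.
have l0 : l = 0.
  apply: (leE_anti hB) => //.
  have := leEZ hB (_ : 0 <= c^-1) cl_le0.
  by rewrite scalerA mulVf// scale1r scaler0; apply; rewrite invr_ge0.
(* Some unit vector [y n] would be at distance less than 1 from 0. *)
have [n _] := hl 1 0%N ltr01.
by rewrite l0 subr0 norm_y ltxx.
Qed.

End KeyLemma.

Lemma measurable_fun_EFin_indic {R : realType} (I A : set R) :
  measurable A -> L0 I (EFin \o \1_A).
Proof. by move=> mA; apply/measurable_EFinP; exact: measurable_indic. Qed.

Lemma distr_indic {R : realType} (I A : set R) (lambda : R) :
  A `<=` I -> 0 <= lambda ->
  distr I (EFin \o \1_A) lambda =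
  if lambda < 1 then lebesgue_measure A else 0%E.
Proof.
move=> AI l0; have [l1|l1] := ltP lambda 1.
  congr lebesgue_measure; apply/seteqP; split => t /=.
    move=> [_]; rewrite lte_fin indicE normr_nat.
    by case: (boolP (t \in A)) => [/set_mem//|_]; rewrite ltNge l0.
  move=> At; split; first exact: AI.
  by rewrite lte_fin indicE mem_set// normr1.
rewrite -(@measure0 _ _ _ lebesgue_measure); congr lebesgue_measure.
apply/seteqP; split => t //= -[_]; rewrite lte_fin indicE normr_nat.
by rewrite ltNge (le_trans _ l1)// lern1; case: (_ \in _).
Qed.

(** * Indicator functions in a symmetric space *)

Section Indicators.
Context {R : realType} {E : completeNormedModType R} {ev : E -> R -> \bar R}
  {alpha : \bar R}.
Let I := halfopen0 alpha.
Context (hE : symmetric_space I ev).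
Let hB : banach_function_space I ev := sym_bfs hE.
Let mI : measurable I := measurable_halfopen0 alpha.
Let mev (x : E) : L0 I (ev x) := bfs_measurable hB x.

Lemma represents_indic_gt0 (A : set R) (a : E) : measurable A -> A `<=` I ->
  (0 < lebesgue_measure A)%E -> represents I ev a (EFin \o \1_A) -> 0 < `|a|.
Proof.
move=> mA AI A0 ha; rewrite normr_gt0; apply/eqP => a0; move: ha A0.
rewrite a0 => ha.
have := distr_eq_ae mI 0 (mev 0) (measurable_fun_EFin_indic mA) ha.
rewrite distr_indic// ltr01 => <-.
rewrite (distr_eq_ae mI 0 (mev 0) (measurable_fun_EFin_indic measurable0)).
  by rewrite distr_indic// ltr01 measure0 ltxx.
by apply: filterS (ev0 hB) => t ->; rewrite /= indic0.
Qed.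

Lemma exists_indic_subset (A B : set R) (b : E) : measurable A -> A `<=` B ->
  represents I ev b (EFin \o \1_B) ->
  exists a : E, represents I ev a (EFin \o \1_A).
Proof.
move=> mA AB hb.
have [||a [ha _]] := @bfs_ideal _ _ _ _ hB (EFin \o \1_A) b; last by exists a.
- exact: measurable_fun_EFin_indic.
- apply: filterS hb => t ->; rewrite /= !lee_fin !indicE !normr_nat ler_nat.
  by case: (boolP (t \in A)) => // /set_mem/AB/mem_set ->.
Qed.

Lemma exists_indic_equimeasurable (A B : set R) (b : E) :
  measurable A -> measurable B -> A `<=` I -> B `<=` I ->
  lebesgue_measure A = lebesgue_measure B ->
  represents I ev b (EFin \o \1_B) ->
  exists a : E, represents I ev a (EFin \o \1_A) /\ `|a| = `|b|.
Proof.
move=> mA mB AI BI AB hb; apply: (sym_distr hE).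
  exact: measurable_fun_EFin_indic.
move=> l l0; rewrite (distr_eq_ae mI l (mev b) (measurable_fun_EFin_indic mB) hb).
by rewrite !distr_indic// AB.
Qed.

(** The indicator of [0, r) is its own decreasing rearrangement, as a comparison of levels through
    [rearr_gtP] shows. *)
Lemma decr_cone_indic (r : R) (a : E) : (r%:E <= alpha)%E -> 0 <= r ->
  represents I ev a (EFin \o \1_(halfopen0 r%:E)) -> decr_cone I ev a.
Proof.
move=> ra r0 ha; exists a.
have rI : halfopen0 r%:E `<=` I.
  by move=> t [t0 tr]; split => //; exact: lt_le_trans ra.
apply: (filterS2 _ _ ha (aeonT I)) => t -> [t0 _].
apply: eq_of_lt_fin; [by rewrite lee_fin|exact: rearr_ge0|move=> l l0].
rewrite rearr_gtP//.
rewrite (distr_eq_ae mI l (mev a) (measurable_fun_EFin_indic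
  (measurable_halfopen0 _)) ha).
rewrite distr_indic// lebesgue_measure_halfopen0 ?lee_fin//= lte_fin indicE.
case: (boolP (t \in _)) => [/set_mem [_ tr]|ntr].
  by case: ifP => // _; rewrite lte_fin ltNge t0.
rewrite [LHS]ltNge l0/=; case: ifP => _; last by rewrite lte_fin ltNge t0.
apply/esym/negbTE; apply: contra ntr => tr.
by apply/mem_set; split.
Qed.

(* The set where |x| > lambda then has the same measure as I, so its indicator is
   equimeasurable with 1_I. *)
Lemma exists_one_of_distr_pinfty (x : E) (lambda : R) :
  alpha = +oo%E -> 0 < lambda -> distr I (ev x) lambda = +oo%E ->
  exists a : E, represents I ev a (EFin \o \1_I).
Proof.
move=> alphaoo l0 xoo.
pose B := I `&` [set s | (lambda%:E < `|ev x s|)%E].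
have mB : measurable B by exact: measurable_distr_set.
have BI : B `<=` I by move=> t [].
have [||b [hb _]] := @bfs_ideal _ _ _ _ hB (EFin \o \1_B) (lambda^-1 *: x).
- exact: measurable_fun_EFin_indic.
- apply: (filterS2 _ _ (bfs_scale hB lambda^-1 x) (aeonT I)) => t -> It.
  rewrite /= abseM abse_EFin gtr0_norm ?invr_gt0// indicE.
  case: (boolP (t \in B)) => [/set_mem [_ /= ltx]|_]; last first.
    by rewrite normr0 mule_ge0// lee_fin invr_ge0 ltW.
  by rewrite normr1 lee_pdivlMl// mule1 ltW.
have [a [ha _]] : exists a : E, represents I ev a (EFin \o \1_I) /\ `|a| = `|b|.
  apply: (exists_indic_equimeasurable _ mB) => //.
  by rewrite lebesgue_measure_halfopen0 alphaoo// -xoo.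
by exists a.
Qed.

End Indicators.

(** * Finiteness of the distribution functions *)

Lemma distr_lt_pinfty {R : realType} (E : completeNormedModType R)
    (ev : E -> R -> \bar R) (k : nat) (alpha : \bar R) :
  alpha = 1%:E \/ alpha = +oo%E ->
  symmetric_space (halfopen0 alpha) ev ->
  fatou_property (halfopen0 alpha) ev ->
  compactly_fully_rotund k (decr_cone (halfopen0 alpha) ev) ->
  forall (x : E) (lambda : R), 0 < lambda ->
    (distr (halfopen0 alpha) (ev x) lambda < +oo)%E.
Proof.
set I := halfopen0 alpha => halpha hE hF hrot x lambda l0.
have mI : measurable I by exact: measurable_halfopen0.
have hB := sym_bfs hE; have mev := bfs_measurable hB.
case: halpha => [alpha1|alphaoo].
  rewrite (@le_lt_trans _ _ 1%:E) ?ltry//.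
  rewrite -[leRHS]lebesgue_measure_halfopen0 ?lee_fin// -alpha1.
  by apply: le_measure; rewrite ?inE//; exact: measurable_distr_set.
rewrite ltey; apply/eqP => xoo.
have [one hone] := exists_one_of_distr_pinfty hE alphaoo l0 xoo.
(* The shift to [n.+1] gives every set positive measure, so that all the norms can be inverted. *)
pose A n : set R := halfopen0 n.+1%:R%:E.
have mA n : measurable (A n) by exact: measurable_halfopen0.
have A_I n : A n `<=` I by move=> t [t0 _]; split => //; rewrite alphaoo ltry.
have A_homo m n : (m <= n)%N -> A m `<=` A n.
  move=> mn t [t0 tm]; split => //; apply: (lt_le_trans tm).
  by rewrite lee_fin ler_nat.
have [u hu] := choice (fun n => exists_indic_subset hE (mA n) (@A_I n) hone).
have u_ge0 n : leE I ev 0 (u n).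
  by apply/(leEP hB); apply: filterS (hu n) => t ->; rewrite lee_fin.
have u_homo m n : (m <= n)%N -> leE I ev (u m) (u n).
  move=> mn; apply: (filterS2 _ _ (hu m) (hu n)) => t -> ->.
  rewrite lee_fin !indicE ler_nat.
  by case: (boolP (t \in A m)) => // /set_mem/(A_homo _ _ mn)/mem_set ->.
have norm_homo m n : (m <= n)%N -> `|u m| <= `|u n|.
  by move=> mn; apply: (leE_norm hB); [exact: u_ge0|exact: u_homo].
have u_gt0 n : 0 < `|u n|.
  apply: (represents_indic_gt0 hE (mA n) (@A_I n) _ (hu n)).
  by rewrite lebesgue_measure_halfopen0.
(* Stated for any representative of 1_I: first [one] bounds the norms for the Fatou property, then
   the element [z] produced by it serves as the sharp bound. *)
have u_norm_le n (b : E) : represents I ev b (EFin \o \1_I) -> `|u n| <= `|b|.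
  move=> hb; apply: (leE_norm hB) => //.
  apply: (filterS2 _ _ (hu n) hb) => t -> ->.
  rewrite lee_fin !indicE ler_nat.
  by case: (boolP (t \in A n)) => // /set_mem/A_I/mem_set ->.
have [z [hz _ cvg_z]] : exists z : E, [/\ represents I ev z (EFin \o \1_I),
    nondecreasing_seq (fun n => `|u n|) & `|u n| @[n --> \oo] --> `|z|].
  apply: hF.
  - by move=> n; apply/(leEP hB).
  - by exists `|one| => _ [n _ <-]; exact: u_norm_le hone.
  - exact: measurable_fun_EFin_indic.
  - apply: (filterS2 _ _ (aeon_foralln hu) (aeonT I)) => t ut It; split.
      move=> m n mn; rewrite !ut lee_fin !indicE ler_nat.
      by case: (boolP (t \in A m)) => // /set_mem/(A_homo _ _ mn)/mem_set ->.
    apply: cvg_near_cst; exists (Num.truncn t) => // n /= tn.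
    rewrite ut /= !indicE mem_set ?mem_set//; split; first by case: It.
    by rewrite lte_fin (lt_le_trans (truncnS_gt t))// ler_nat.
set C := `|z| in cvg_z.
have u_le n : `|u n| <= C.
  exact: u_norm_le hz.
have C_gt0 : 0 < C by exact: lt_le_trans (u_gt0 0%N) (u_le 0%N).
pose y n := `|u n|^-1 *: u n.
have norm_y n : `|y n| = 1.
  by rewrite normrZ normfV normr_id mulVf// gt_eqF.
have [|eps eps0|l hl] := @rotund_cluster _ _ _ _ hB k _ y hrot.
- move=> n; split => //; apply: decr_coneZ => //; first by rewrite invr_gt0.
  by apply: (decr_cone_indic hE _ _ (hu n)) => //; rewrite alphaoo leey.
- have /cvgrPdist_le/(_ (eps * C) (mulr_gt0 eps0 C_gt0))[n0 _] := cvg_z.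
  move=> /(_ n0 (leqnn n0)) /=; rewrite ger0_norm ?subr_ge0// => hn0.
  (* Here functions and norms increase to a limit, so one minorant serves every [N]: u_{n0} <= u_n
     and C^-1 <= |u n|^-1, with norm |u n0| / C >= 1 - eps. *)
  exists n0 => N; exists (C^-1 *: u n0); split.
  + rewrite -(scaler0 _ C^-1); apply: leEZ => //.
    by rewrite invr_ge0 ltW.
  + rewrite normrZ gtr0_norm ?invr_gt0// mulrC ler_pdivlMr//.
    by rewrite mulrBl mul1r lerBlDr -lerBlDl.
  + move=> n /andP[n0n nN]; apply: (@leE_trans _ _ _ _ (C^-1 *: u n)).
      by apply: leEZ => //; [rewrite invr_ge0 ltW|exact: u_homo].
    by apply: leEZr => //; rewrite lef_pV2 ?posrE.
(* Two terms within [eps] of [l] differ by less than |u 0| / C in norm. *)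
pose eps := `|u 0%N| / C / 2.
have eps0 : 0 < eps by rewrite !divr_gt0.
have [n _ yn] := hl eps 0%N eps0.
have [m nm ym] := hl eps n.+1 eps0.
(* This unit interval misses [A n] and lies in [A m] because m > n. On it y_n = 0 and y_m = |u m|^-1
   >= C^-1, so y_m - y_n dominates a copy of C^-1 1_[0,1). *)
pose A' : set R := `[n.+1%:R, n.+2%:R[%classic.
have mA' : measurable A' by exact: measurable_itv.
have A'I : A' `<=` I.
  move=> t; rewrite /A' /= in_itv/= => /andP[nt _]; split.
    by rewrite (le_trans _ nt).
  by rewrite alphaoo ltry.
have [v [hv vu]] : exists v : E, represents I ev v (EFin \o \1_A') /\
    `|v| = `|u 0%N|.
  apply: (exists_indic_equimeasurable hE mA' (mA 0%N)) => //.
  rewrite lebesgue_measure_halfopen0 ?lee_fin// lebesgue_measure_itv/=.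
  by rewrite lte_fin ltr_nat ltnSn -EFinB -natrB// subSnn.
have : `|C^-1 *: v| <= `|y m - y n|.
  apply: (norm_le_ae hB).
  apply: (filterS3 _ _ (filterI (bfs_scale hB C^-1 v) hv)
    (filterI (bfs_scale hB `|u m|^-1 (u m)) (bfs_scale hB `|u n|^-1 (u n)))
    (filterI (evB hB (y m) (y n)) (filterI (hu m) (hu n)))).
  move=> t [-> ->] [hym hyn] [-> [um un]].
  rewrite /y hym hyn um un /= !indicE.
  case: (boolP (t \in A')) => [/set_mem|_]; last first.
    by rewrite mulr0n mulr0 normr0 lee_fin.
  rewrite /A' /= in_itv/= => /andP[nt tn].
  rewrite mem_set; last first.
    split; first by rewrite (le_trans _ nt).
    by rewrite lte_fin (lt_le_trans tn)// ler_nat ltnS.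
  rewrite memNset; last by move=> [_]; rewrite lte_fin ltNge nt.
  rewrite mulr0n mulr1n !mulr1 mulr0 subr0 lee_fin !gtr0_norm ?invr_gt0//.
  by rewrite lef_pV2 ?posrE.
apply/negP; rewrite -ltNge normrZ vu gtr0_norm ?invr_gt0// mulrC.
rewrite (_ : y m - y n = (y m - l) - (y n - l)); last first.
  by rewrite opprB addrA subrK.
rewrite (le_lt_trans (ler_normB _ _))// [ltRHS]splitr.
exact: ltrD.
Qed.

(** * Order continuity *)

Theorem proposition5p1 (R : realType) (alpha : \bar R)
    (halpha : alpha = 1%:E \/ alpha = +oo%E)
    (k : nat) (hk : (2 <= k)%N)
    (E : completeNormedModType R) (ev : E -> R -> \bar R)
    (hE : symmetric_space (halfopen0 alpha) ev)
    (hF : fatou_property (halfopen0 alpha) ev)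
    (hrot : compactly_fully_rotund k (decr_cone (halfopen0 alpha) ev)) :
  order_continuous (halfopen0 alpha) ev.
Proof.
move=> x x_ x_ge0 x_le x_cvg.
have distr_fin := distr_lt_pinfty halpha hE hF hrot.
set I := halfopen0 alpha in hE hF hrot x_ge0 x_le x_cvg distr_fin *.
have mI : measurable I by exact: measurable_halfopen0.
have hB := sym_bfs hE; have mev := bfs_measurable hB.
(* With absolute values, positivity and monotonicity of [v] hold at every point, although [x_ m] is
   nonnegative only almost everywhere. *)
pose v n t := esups (fun m => `|ev (x_ m) t|%E) n.
have mv n : L0 I (v n).
  apply: (@measurable_fun_esups _ _ _ I (fun m t => `|ev (x_ m) t|%E)) => m.
  by apply: measurableT_comp => //; exact: mev.
have v_ge m n t : (n <= m)%N -> (`|ev (x_ m) t| <= v n t)%E.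
  by move=> nm; apply: ereal_sup_ubound; exists m.
have v_ge0 n t : (0 <= v n t)%E by exact: le_trans (v_ge n n t (leqnn n)).
have v_anti m n t : (m <= n)%N -> (v n t <= v m t)%E.
  exact: nonincreasing_esups.
have /choice[w hw] n : exists z : E, represents I ev z (v n).
  (* The supremum inherits the common bound |x| and so belongs to [E] by the ideal property. *)
  have [|z [hz _]] := bfs_ideal hB (mv n) (_ : aeon I (fun t => _ <= `|ev x t|)%E);
    last by exists z.
  apply: (filterS2 _ _ (aeon_foralln x_ge0) (aeon_foralln x_le)) => t x0 xx.
  rewrite gee0_abs//; apply: ge_ereal_sup => _ [m _ <-].
  by rewrite gee0_abs.
have w_ge0 n : leE I ev 0 (w n).
  by apply/(leEP hB); apply: filterS (hw n) => t ->.
have : `|w n| @[n --> \oo] --> (0 : R).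
  apply: (norm_cvg0_of_distr hE hrot) => // [m n mn|lambda d lambda0 d0].
    by apply: (filterS2 _ _ (hw m) (hw n)) => t -> ->; exact: v_anti.
  pose F n := I `&` [set s | (lambda%:E < `|v n s|)%E].
  have mF n : measurable (F n) by apply: measurable_distr_set.
  have distr_w n : distr I (ev (w n)) lambda = lebesgue_measure (F n).
    exact: (distr_eq_ae mI lambda (mev (w n)) (mv n) (hw n)).
  have mcapF : measurable (\bigcap_n F n) by exact: bigcapT_measurable.
  (* At a point of the intersection the upper limit of |x_m| is at least [lambda], so convergence to
     0 fails there. *)
  have capF0 : lebesgue_measure (\bigcap_n F n) = 0%E.
    have [N [mN N0 hN]] := x_cvg.
    apply: (@subset_measure0 _ _ _ lebesgue_measure _ _ mcapF mN _ N0) => t Ft.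
    apply: hN => /= xt0.
    have It : I t by case: (Ft 0%N Logic.I).
    have xt_abs : `|ev (x_ n) t|%E @[n --> \oo] --> (0 : \bar R)%E.
      by rewrite -abse0; apply: cvg_abse; exact: xt0.
    have vt0 : v n t @[n --> \oo] --> (0 : \bar R)%E by exact: cvg_esups.
    have : (lambda%:E <= 0)%E.
      apply: (cvge_ge _ vt0); apply: nearW => n.
      by have [_ /=] := Ft n Logic.I; rewrite gee0_abs// => /ltW.
    by rewrite lee_fin leNgt lambda0.
  have cvgF : lebesgue_measure (F n) @[n --> \oo] --> (0 : \bar R)%E.
    (* Continuity from above requires [F 0] to have finite measure, which [distr_fin] supplies. *)
    rewrite -capF0; apply: nonincreasing_cvg_mu => //.
      by have := distr_fin (w 0%N) lambda lambda0; rewrite distr_w.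
    move=> m n mn; apply/subsetPset => t [It /= ht]; split => //=.
    by move: ht; rewrite !gee0_abs// => /lt_le_trans; apply; exact: v_anti.
  apply: contrapT => /forallNP hn.
  have : (d%:E <= 0)%E.
    apply: (cvge_ge _ cvgF); apply: nearW => n.
    by have /negP := hn n; rewrite -ltNge distr_w => /ltW.
  by rewrite lee_fin leNgt d0.
apply: squeeze_cvgr; last exact: cvg_cst.
apply: nearW => n; rewrite normr_ge0/=; apply: (leE_norm hB).
  by apply/(leEP hB); exact: x_ge0.
apply: (filterS2 _ _ (hw n) (x_ge0 n)) => t -> x0.
by rewrite -(gee0_abs x0); exact: v_ge.
Qed.
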